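(* Consider $\dot x=A(t)x+B(t)w$, $y=C(t)x+D(t)w$, with $A,B,C,D$ real, piecewise-continuous, $T$-periodic, $(A,B)$ controllable, $(C,A)$ detectable, $D(t)[B(t)^\top\ \ D(t)^\top]=[0\ \ I]$, disturbances $\|w(t)\|\le1$, and observer $\dot{\hat x}=A\hat x+L(t)(C\hat x-y)$ with weighted error output $z=C_w(t)(x-\hat x)$, $C_w$ piecewise-continuous and $T$-periodic. For a given positive $T$-periodic $\alpha(\cdot)$, the optimal observer gain $L^*_\alpha=\arg\min_L\operatorname{size}(\mathcal{E}_{\alpha,L})$ is $$L(t)=-\alpha(t)P(t)C(t)^\top,$$ where $P(t)=P(t+T)\succ0$ solves $$\dot P(t)=A(t)P(t)+P(t)A(t)^\top+\alpha(t)P(t)+\frac1{\alpha(t)}B(t)B(t)^\top-\alpha(t)P(t)C(t)^\top C(t)P(t).$$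
   Context: The error $e=x-\hat x$ obeys $\dot e=A_L e+B_L w$, $z=C_we$, with $A_L=A+LC$, $B_L=B+LD$. For a $T$-periodic $L(\cdot)$, $\mathcal{E}_{\alpha,L}(t)=\{\mathrm{e}:\mathrm{e}^\top P_L(t)^{-1}\mathrm{e}\le1\}$ where $P_L(t)=P_L(t+T)\succ0$ solves $\dot P_L=A_LP_L+P_LA_L^\top+\alpha P_L+\frac1\alpha B_LB_L^\top$ (the minimal periodic inescapable ellipsoid of the error system for the given $\alpha$), and $\operatorname{size}(\mathcal{E}_{\alpha,L})=\frac1T\int_0^T\mathrm{trace}\big(C_w(t)P_L(t)C_w(t)^\top\big)dt$. *)

(* Defs.v *)
From HB Require Import structures.
From mathcomp Require Import all_boot all_order all_algebra.
From mathcomp Require Import all_classical all_reals all_analysis.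
Set Implicit Arguments. Unset Strict Implicit. Unset Printing Implicit Defensive.
Import Order.TTheory GRing.Theory Num.Theory.
Import numFieldNormedType.Exports.
Local Open Scope classical_set_scope.
Local Open Scope ring_scope.

Section Defs.
Context {R : realType}.

Definition Tperiodic {X : Type} (T : R) (f : R -> X) := forall t, f (t + T) = f t.

Definition piecewise_continuous {V : normedModType R} (f : R -> V) :=
  forall a b : R, a < b -> exists p : seq R,
    [/\ path <%R a p, last a p = b &
      forall i, (i < size p)%N ->
        let l := nth a (a :: p) i in let r := nth a p i in
        [/\ {in `]l, r[, continuous f},
            cvg (f @ at_right l) & cvg (f @ at_left r)]].

Definition posdef {n : nat} (M : 'M[R]_n) :=
  M^T = M /\ forall v : 'cV[R]_n, v != 0 -> 0 < (v^T *m M *m v) 0 0.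

(* Solution (in the Caratheodory sense, for a right-hand side that is
   piecewise continuous in t) of x' = g: x is continuous and, at every time
   where the right-hand side g is continuous, x is differentiable with
   derivative g t. *)
Definition ode_sol {V : normedModType R} (x g : R -> V) :=
  continuous x /\ forall t, {for t, continuous g} -> is_derive t 1 x (g t).

Definition controllable {n m : nat} (A : R -> 'M[R]_n) (B : R -> 'M[R]_(n, m)) :=
  forall (t0 : R) (x0 x1 : 'cV[R]_n), exists t1, t0 < t1 /\
    exists (u : R -> 'cV[R]_m) (x : R -> 'cV[R]_n),
      [/\ piecewise_continuous u,
          ode_sol x (fun t => A t *m x t + B t *m u t),
          x t0 = x0 & x t1 = x1].

Definition detectable {n p : nat} (C : R -> 'M[R]_(p, n)) (A : R -> 'M[R]_n) :=
  forall (t0 : R) (x : R -> 'cV[R]_n),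
    ode_sol x (fun t => A t *m x t) ->
    (forall t, t0 <= t -> C t *m x t = 0) ->
    x t @[t --> +oo] --> (0 : 'cV[R]_n).

Definition error_ellipsoid {n m p : nat} (T : R) (A : R -> 'M[R]_n)
  (B : R -> 'M[R]_(n, m)) (C : R -> 'M[R]_(p, n)) (D : R -> 'M[R]_(p, m))
  (alpha : R -> R) (L : R -> 'M[R]_(n, p)) (PL : R -> 'M[R]_n) :=
  let AL := fun t => A t + L t *m C t in
  let BL := fun t => B t + L t *m D t in
  [/\ Tperiodic T PL, forall t, posdef (PL t) &
      ode_sol PL (fun t => AL t *m PL t + PL t *m (AL t)^T + alpha t *: PL t
                           + (alpha t)^-1 *: (BL t *m (BL t)^T))].

Definition ellipsoid_size {n q : nat} (T : R) (Cw : R -> 'M[R]_(q, n))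
  (PL : R -> 'M[R]_n) : R :=
  T^-1 * Rintegral lebesgue_measure `[0, T]
                     (fun t => \tr (Cw t *m PL t *m (Cw t)^T)).

Definition riccati_sol {n m p : nat} (T : R) (A : R -> 'M[R]_n)
  (B : R -> 'M[R]_(n, m)) (C : R -> 'M[R]_(p, n)) (alpha : R -> R)
  (P : R -> 'M[R]_n) :=
  [/\ Tperiodic T P, forall t, posdef (P t) &
      ode_sol P (fun t => A t *m P t + P t *m (A t)^T + alpha t *: P t
                          + (alpha t)^-1 *: (B t *m (B t)^T)
                          - alpha t *: (P t *m (C t)^T *m C t *m P t))].

End Defs.

(* Main.v *)
Require Import Defs.
From HB Require Import structures.
From mathcomp Require Import all_boot all_order all_algebra.
From mathcomp Require Import all_classical all_reals all_analysis.
From mathcomp Require Import measurable_realfun ring lra.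
Import Order.TTheory GRing.Theory Num.Theory.
Import numFieldNormedType.Exports.
Local Open Scope classical_set_scope.
Local Open Scope ring_scope.

(** For an arbitrary periodic gain [L], put [G = L + alpha P C^T] and
    [F = A + L C + alpha / 2]. Completing the square in the two matrix equations
    shows that the gap [PL - P] solves the Lyapunov equation
    [X' = F X + X F^T + alpha^-1 G G^T], whose forcing term is positive
    semidefinite, so it suffices to show that its periodic solution is positive
    semidefinite; the sizes then compare pointwise under the integral.

    If the gap is not positive semidefinite at time [a], let [c > 0] be the least
    constant for which [S = PL - P + c PL] is so at [a], and let [w] be a nonzero
    vector with [w^T S(a) w = 0]. Solve the adjoint equation [eta' = - F^T eta]
    backwards from [eta(b) = w], where [b = a + k T] lies beyond the times at which
    every basis vector can be steered from time [a] to 0. The form [eta^T S eta] is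
    nondecreasing, nonnegative at [a] and zero at [b], hence constant, which forces
    [(B + L D)^T eta = 0]; since [D B^T = 0] and [D D^T = 1] this gives
    [L^T eta = 0] and [B^T eta = 0]. For a controlled trajectory [x] the pairing
    [eta^T x] then satisfies a homogeneous scalar linear equation, so steering [x]
    to 0 forces [eta(a)^T x(a) = 0]. Hence [eta(a) = 0], and so [w = eta(b) = 0].

    Coefficients are only continuous off finitely many points and [alpha^-1] may be
    unbounded, so every differential inequality is used in its monotone form. *)

Set Implicit Arguments.
Unset Strict Implicit.
Unset Printing Implicit Defensive.

(** * Matrix-valued functions *)

Section MatrixLimits.
Context {R : realType}.

(** The norm is the largest absolute value among finitely many entries, so one set of the filter
    serves them all. An arbitrary filter covers limits at a point, one-sided limits and limits
    within an interval at once. *)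
Lemma cvg_mxP {U : Type} (F : set_system U) {FF : Filter F} {m n : nat}
    (f : U -> 'M[R]_(m, n)) (M : 'M[R]_(m, n)) :
  f x @[x --> F] --> M <-> forall i j, f x i j @[x --> F] --> M i j.
Proof.
split=> [fM i j|fM].
  exact: (cvg_comp _ _ fM (@coord_continuous R m n i j M)).
apply/cvgrPdist_le => e e0.
have : \forall x \near F, forall ij : 'I_m * 'I_n,
    `|M ij.1 ij.2 - f x ij.1 ij.2| <= e.
  apply: filter_forall => ij.
  by move/cvgrPdist_le : (fM ij.1 ij.2) => /(_ _ e0).
apply: filterS => x Mx.
rewrite /Num.Def.normr/= mx_normrE (bigmax_le _ (ltW e0))//= => ij _.
by rewrite !mxE.
Qed.

Lemma cvg_mulmx {U : Type} (F : set_system U) {FF : Filter F} {m n p : nat}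
    (f : U -> 'M[R]_(m, n)) (g : U -> 'M[R]_(n, p)) (M : 'M[R]_(m, n))
    (N : 'M[R]_(n, p)) :
  f x @[x --> F] --> M -> g x @[x --> F] --> N ->
  f x *m g x @[x --> F] --> M *m N.
Proof.
move=> /cvg_mxP fM /cvg_mxP gN; apply/cvg_mxP => i j; rewrite mxE.
under eq_fun do rewrite mxE.
by apply: cvg_big => [|k _]; [exact: add_continuous|exact: cvgM].
Qed.

Lemma cvg_trmx {U : Type} (F : set_system U) {FF : Filter F} {m n : nat}
    (f : U -> 'M[R]_(m, n)) (M : 'M[R]_(m, n)) :
  f x @[x --> F] --> M -> (f x)^T @[x --> F] --> M^T.
Proof.
move=> /cvg_mxP fM; apply/cvg_mxP => i j; rewrite mxE.
by under eq_fun do rewrite mxE; exact: fM.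
Qed.

Lemma continuous_mulmx {U : topologicalType} {m n p : nat}
    (f : U -> 'M[R]_(m, n)) (g : U -> 'M[R]_(n, p)) (t : U) :
  {for t, continuous f} -> {for t, continuous g} ->
  {for t, continuous (fun s => f s *m g s)}.
Proof. exact: cvg_mulmx. Qed.

Lemma continuous_trmx {U : topologicalType} {m n : nat}
    (f : U -> 'M[R]_(m, n)) (t : U) :
  {for t, continuous f} -> {for t, continuous (fun s => (f s)^T)}.
Proof. exact: cvg_trmx. Qed.

Lemma norm_mx_entry_le {m n : nat} (M : 'M[R]_(m, n)) i j : `|M i j| <= `|M|.
Proof.
by rewrite [leRHS]/Num.Def.normr/= mx_normrE; exact: (le_bigmax _ _ (i, j)).
Qed.

(** The maximum norm is not submultiplicative: each entry of the product is a sum of [n] terms,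
    whence the factor. *)
Lemma norm_mulmx_le {m n p : nat} (M : 'M[R]_(m, n)) (N : 'M[R]_(n, p)) :
  `|M *m N| <= n%:R * `|M| * `|N|.
Proof.
rewrite [leLHS]/Num.Def.normr/= mx_normrE bigmax_le//= ?mulr_ge0// => ij _.
rewrite mxE (le_trans (ler_norm_sum _ _ _))//.
apply: (@le_trans _ _ (\sum_(k < n) `|M| * `|N|)).
  by apply: ler_sum => k _; rewrite normrM ler_pM ?norm_mx_entry_le.
by rewrite sumr_const card_ord -mulrA mulr_natl.
Qed.

Lemma is_derive_mxP {m n : nat} (M : R -> 'M[R]_(m, n)) (t : R) D :
  is_derive t 1 M D <-> forall i j, is_derive t 1 (fun s => M s i j) (D i j).
Proof.
split=> [[dM <-] i j|dM].
  apply: DeriveDef; first by move/derivable_mxP : dM; exact.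
  by rewrite derive_mx// mxE.
have M' : derivable M t 1.
  by apply/derivable_mxP => i j; have [] := dM i j.
apply: DeriveDef => //; rewrite derive_mx//; apply/matrixP => i j.
by rewrite mxE derive_val.
Qed.

Lemma is_derive_mulmx {m n p : nat} (M : R -> 'M[R]_(m, n))
    (N : R -> 'M[R]_(n, p)) (t : R) M' N' :
  is_derive t 1 M M' -> is_derive t 1 N N' ->
  is_derive t 1 (fun s => M s *m N s) (M' *m N t + M t *m N').
Proof.
move=> /is_derive_mxP dM /is_derive_mxP dN; apply/is_derive_mxP => i j.
under eq_fun do rewrite mxE.
rewrite (_ : (fun _ => _) = \sum_(k < n) (fun s => M s i k * N s k j)); last first.
  by apply/funext => s; rewrite fct_sumE.
have dk k : is_derive t 1 (fun s => M s i k * N s k j)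
                          (M t i k *: N' k j + N t k j *: M' i k).
  exact: (is_deriveM (dM i k) (dN k j)).
apply: is_derive_eq; rewrite !mxE -big_split/=; apply: eq_bigr => k _.
by rewrite addrC; congr (_ + _); rewrite /GRing.scale/= mulrC.
Qed.

Lemma is_derive_trmx {m n : nat} (M : R -> 'M[R]_(m, n)) (t : R) M' :
  is_derive t 1 M M' -> is_derive t 1 (fun s => (M s)^T) M'^T.
Proof.
move=> /is_derive_mxP dM; apply/is_derive_mxP => i j; rewrite mxE.
by under eq_fun do rewrite mxE; exact: dM.
Qed.

End MatrixLimits.

(** * Differentiation off finitely many points *)

(* The filter of the sets that contain all but finitely many points of ]a, b[. *)
Definition almost {R : realType} (a b : R) : set_system R :=
  [set P | exists s : seq R, forall t, t \in `]a, b[ -> t \notin s -> P t].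

Global Instance almost_filter {R : realType} (a b : R) : Filter (almost a b).
Proof.
split; first by exists [::].
- move=> P Q [s sP] [s' sQ]; exists (s ++ s') => t tab.
  by rewrite mem_cat negb_or => /andP[ts ts']; split; [exact: sP|exact: sQ].
- by move=> P Q PQ [s sP]; exists s => t tab ts; exact/PQ/sP.
Qed.

Section Almost.
Context {R : realType}.
Implicit Types a b c d : R.

Lemma almost_itvW a b c d (P : set R) : a <= c -> d <= b ->
  almost a b P -> almost c d P.
Proof.
move=> ac db [s sP]; exists s => t; rewrite in_itv/= => /andP[ct td] ts.
by apply: sP => //; rewrite in_itv/= (le_lt_trans ac)//= (lt_le_trans td).
Qed.

Lemma almost_inner a b : almost a b [set t | t \in `]a, b[].
Proof. by exists [::]. Qed.

(** Induction on the exceptional points: the interval is cut at each one inside it, and the mean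
    value theorem applies on the remaining pieces. Only the sign of [df] enters, so [df] may be
    unbounded. *)
Lemma almost_ger0_derive_le a b (f df : R -> R) : a <= b ->
  {within `[a, b], continuous f} ->
  (\forall t \near almost a b, is_derive (t : R) 1 f (df t) /\ 0 <= df t) ->
  f a <= f b.
Proof.
move=> + + [s]; elim: s a b => [|x s IHs] a b ab cf dfP.
  move: ab; rewrite le_eqVlt => /predU1P[->//|ab].
  have [t tab|c cab fba] := @MVT R f df a b ab _ cf; first by case: (dfP t tab).
  rewrite -subr_ge0 fba mulr_ge0 ?subr_ge0 ?(ltW ab)//.
  by have [] := dfP c cab isT.
have [xab|xNab] := boolP (x \in `]a, b[); last first.
  apply: IHs => // t tab ts; apply: dfP => //; rewrite inE negb_or ts andbT.
  by apply: contraNneq xNab => <-.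
move: (xab); rewrite in_itv/= => /andP[ax xb].
apply: (@le_trans _ _ (f x)).
- apply: IHs => //; first exact: ltW.
  + by apply: continuous_subspaceW cf; apply: subset_itvl; rewrite bnd_simp ltW.
  + move=> t; rewrite in_itv/= => /andP[at_ tx] ts; apply: dfP.
      by rewrite in_itv/= at_ (lt_trans tx).
    by rewrite inE negb_or ts lt_eqF.
- apply: IHs => //; first exact: ltW.
  + by apply: continuous_subspaceW cf; apply: subset_itvr; rewrite bnd_simp ltW.
  + move=> t; rewrite in_itv/= => /andP[xt tb] ts; apply: dfP.
      by rewrite in_itv/= tb (lt_trans ax).
    by rewrite inE negb_or ts gt_eqF.
Qed.

(** Both [f - g] and [- f - g] are nondecreasing, so their nonpositivity at [b] propagates backwards
    to every earlier time. *)
Lemma almost_norm_derive_le a b (f df g dg : R -> R) :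
  {within `[a, b], continuous f} -> {within `[a, b], continuous g} ->
  (\forall t \near almost a b, [/\ is_derive (t : R) 1 f (df t),
     is_derive (t : R) 1 g (dg t) & `|df t| <= - dg t]) ->
  f b = 0 -> 0 <= g b -> forall t, t \in `[a, b] -> `|f t| <= g t.
Proof.
move=> cf cg dfg fb0 gb0 t; rewrite in_itv/= => /andP[at_ tb].
have sub : `[t, b] `<=` `[a, b] by apply: subset_itvr; rewrite bnd_simp.
have {}cf : {within `[t, b], continuous f} by exact: continuous_subspaceW cf.
have {}cg : {within `[t, b], continuous g} by exact: continuous_subspaceW cg.
have {}dfg := almost_itvW at_ (lexx b) dfg.
have fg : f t - g t <= f b - g b.
  apply: (@almost_ger0_derive_le t b (f \- g) (df \- dg)) => //.
    by move=> x; apply: continuousB; [exact: cf|exact: cg].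
  apply: filterS dfg => x [dfx dgx le]; split; first exact: is_deriveB.
  by rewrite /= subr_ge0 -lerN2 (le_trans (ler_norm _))// normrN.
have gf : - f t - g t <= - f b - g b.
  apply: (@almost_ger0_derive_le t b (- f \- g) (- df \- dg)) => //.
    by move=> x; apply: continuousB; [apply: continuousN; exact: cf|exact: cg].
  apply: filterS dfg => x [dfx dgx le]; split; first exact: is_deriveB.
  by rewrite /= subr_ge0 -lerN2 opprK (le_trans (ler_norm _)).
rewrite ler_norml; apply/andP; split; lra.
Qed.

End Almost.

(** * Piecewise continuous functions *)

Section PiecewiseContinuous.
Context {R : realType}.

(** Cells open on the left contain the times just before [t], as limits from the left require; the
    mirrored version below serves limits from the right. *)
Lemma path_cover_oc (a t : R) (p : seq R) : a < t <= last a p ->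
  exists2 i, (i < size p)%N & nth a (a :: p) i < t <= nth a p i.
Proof.
elim: p a => [|x p IHp] a /=; first by move=> /andP[/lt_le_trans H /H]; rewrite ltxx.
move=> /andP[at_ tp]; have [tx|xt] := leP t x; first by exists 0%N => //=; rewrite at_.
have /IHp[i ip it] : x < t <= last x p by rewrite xt.
exists i.+1 => //=; rewrite (set_nth_default x) ?(set_nth_default x a)//=.
exact: (leq_trans ip).
Qed.

Lemma path_cover_co (a t : R) (p : seq R) : a <= t < last a p ->
  exists2 i, (i < size p)%N & nth a (a :: p) i <= t < nth a p i.
Proof.
elim: p a => [|x p IHp] a /=; first by move=> /andP[/le_lt_trans H /H]; rewrite ltxx.
move=> /andP[at_ tp]; have [xt|tx] := leP x t; last by exists 0%N => //=; rewrite at_.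
have /IHp[i ip it] : x <= t < last x p by rewrite xt.
exists i.+1 => //=; rewrite (set_nth_default x) ?(set_nth_default x a)//=.
exact: (leq_trans ip).
Qed.

Context {V : normedModType R}.
Implicit Types f : R -> V.

Lemma continuous_cvg_right f (t : R) : {for t, continuous f} -> cvg (f @ t^'+).
Proof. by move=> cf; apply/cvg_ex; exists (f t); exact: cvg_at_right_filter. Qed.

Lemma continuous_cvg_left f (t : R) : {for t, continuous f} -> cvg (f @ t^'-).
Proof. by move=> cf; apply/cvg_ex; exists (f t); exact: cvg_at_left_filter. Qed.

(** A description without partitions: since [almost] is a filter, several functions can be combined
    without refining their partitions to a common one. Conversely, a partition is rebuilt by cutting
    at the exceptional points one at a time. *)
Lemma piecewise_continuousP f : piecewise_continuous f <->
  (forall t : R, cvg (f @ t^'+) /\ cvg (f @ t^'-)) /\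
  (forall a b : R, a < b -> \forall t \near almost a b, {for (t : R), continuous f}).
Proof.
split=> [pcf|[flr fab]].
  split=> [t|a b ab].
    have t11 : t - 1 < t + 1 by lra.
    have [p [_ plast pP]] := pcf _ _ t11; split.
      have [|i ip /andP[]] := @path_cover_co (t - 1) t p.
        by rewrite plast; apply/andP; split; lra.
      have [ci ri _] := pP i ip.
      rewrite le_eqVlt => /predU1P[<- _//|lt tr].
      by apply: continuous_cvg_right; apply: ci; rewrite in_itv/= lt.
    have [|i ip /andP[lt]] := @path_cover_oc (t - 1) t p.
      by rewrite plast; apply/andP; split; lra.
    have [ci _ li] := pP i ip.
    rewrite le_eqVlt => /predU1P[->//|tr].
    by apply: continuous_cvg_left; apply: ci; rewrite in_itv/= lt.
  have [p [_ plast pP]] := pcf _ _ ab; exists p => t.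
  rewrite in_itv/= => /andP[at_ tb] tp.
  have [|i ip /andP[lt tr]] := @path_cover_oc a t p.
    by rewrite plast at_ ltW.
  have [ci _ _] := pP i ip; apply: ci; rewrite in_itv/= lt lt_neqAle tr andbT.
  by apply: contraNneq tp => ->; exact: mem_nth.
move=> a b ab; have [s] := fab a b ab; elim: s a b ab => [|x s IHs] a b ab sP.
  exists [:: b]; split; rewrite /= ?andbT// => -[|//] _; split.
  - by move=> t tab; exact: sP.
  - by case: (flr a).
  - by case: (flr b).
have [xab|xNab] := boolP (x \in `]a, b[); last first.
  apply: IHs => // t tab ts; apply: sP => //; rewrite inE negb_or ts andbT.
  by apply: contraNneq xNab => <-.
move: (xab); rewrite in_itv/= => /andP[ax xb].
have [|p [pp plast pP]] := IHs a x ax.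
  move=> t; rewrite in_itv/= => /andP[at_ tx] ts; apply: sP.
    by rewrite in_itv/= at_ (lt_trans tx).
  by rewrite inE negb_or ts lt_eqF.
have [|p' [pp' plast' pP']] := IHs x b xb.
  move=> t; rewrite in_itv/= => /andP[xt tb] ts; apply: sP.
    by rewrite in_itv/= tb (lt_trans ax).
  by rewrite inE negb_or ts gt_eqF.
exists (p ++ p'); rewrite cat_path last_cat plast pp; split => // i.
rewrite size_cat -cat_cons => ipp'; have [ip|pi] := ltnP i (size p).
  by rewrite !nth_cat/= ltnS (ltnW ip) ip; exact: pP.
have [j ij] : exists j, i = (size p + j)%N by exists (i - size p)%N; rewrite subnKC.
rewrite {}ij ltn_add2l in ipp' *.
have := pP' j ipp'.
rewrite !nth_cat/= addKn (ltnNge _ (size p)) leq_addr/=.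
have -> : nth a p' j = nth x p' j by exact: set_nth_default.
(* For [j = 0] the left endpoint is the last point of [a :: p], that is, the junction [x]; otherwise
   it lies in [p'], one index lower. *)
case: j ipp' => [|j] jp' /=.
  by rewrite addn0 ltnSn -last_nth plast.
rewrite addnS ltnS ltnNge leq_addr/= subSS addKn.
by have -> : nth a p' j = nth x p' j by apply: set_nth_default; exact: ltnW.
Qed.

Lemma piecewise_continuous_continuous f : continuous f -> piecewise_continuous f.
Proof.
move=> cf; apply/piecewise_continuousP; split=> [t|a b _].
  by split; [apply: continuous_cvg_right|apply: continuous_cvg_left]; exact: cf.
by exists [::] => t _ _; exact: cf.
Qed.

Lemma piecewise_continuous_almost f (a b : R) : piecewise_continuous f ->
  \forall t \near almost a b, {for (t : R), continuous f}.
Proof.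
move=> /piecewise_continuousP[_ fab]; have [ab|ba] := ltP a b; first exact: fab.
by exists [::] => t; rewrite in_itv/= => /andP[/lt_trans H /H]; rewrite ltNge ba.
Qed.

(** The two one-sided limits and the value at [t] bound [f] near [t]; compactness of the segment
    makes the bound uniform. *)
Lemma piecewise_continuous_bounded f (a b : R) : piecewise_continuous f ->
  exists2 K : R, 0 < K & forall t, t \in `[a, b] -> `|f t| <= K.
Proof.
move=> /piecewise_continuousP[flr _].
have : \forall K \near +oo, `[a, b] `<=` [set t | `|f t| <= K].
  have /compact_near_coveringP := @segment_compact R a b.
  apply => t _; have [/cvg_ex[/= r fr] /cvg_ex[/= l fl]] := flr t.
  have lt1 (z : R) : z < z + 1 by rewrite ltrDl.
  have fnr : \forall s \near t, t < s -> `|f s| <= `|r| + 1 :=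
    cvgr_norm_le _ fr _ (lt1 `|r|).
  have fnl : \forall s \near t, s < t -> `|f s| <= `|l| + 1 :=
    cvgr_norm_le _ fl _ (lt1 `|l|).
  have [N [Nr Nl Nt]] : exists N, [/\ `|r| + 1 <= N, `|l| + 1 <= N & `|f t| <= N].
    exists (`|r| + `|l| + `|f t| + 1).
    by split; have := normr_ge0 r; have := normr_ge0 l; have := normr_ge0 (f t); lra.
  have ftN : \forall s \near t, `|f s| <= N.
    near=> s; have [st|ts|->//] := ltgtP s t.
      by apply: le_trans Nl; move: st; near: s; exact: fnl.
    by apply: le_trans Nr; move: ts; near: s; exact: fnr.
  exists ([set s | `|f s| <= N], [set K | N <= K]) => /=.
    by split; [exact: ftN|apply: nbhs_pinfty_ge; exact: num_real].
  by move=> [s K] /= [fsN NK]; exact: (le_trans fsN).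
move=> fK; have [K [K0 fabK]] := filter_ex (filterI (nbhs_pinfty_gt (num_real 0)) fK).
by exists K => // t tab; exact: fabK.
Unshelve. all: by end_near. Qed.

End PiecewiseContinuous.

Section PiecewiseContinuousAlgebra.
Context {R : realType}.

(** Continuity of [h] is assumed along every filter, so that the same hypothesis yields both
    one-sided limits and continuity at a point. Unary operations ignore the second argument. *)
Lemma piecewise_continuous_map2 (U V W : normedModType R) (h : U -> V -> W)
    (f : R -> U) (g : R -> V) :
  (forall (F : set_system R), Filter F -> forall u v,
     f t @[t --> F] --> u -> g t @[t --> F] --> v -> h (f t) (g t) @[t --> F] --> h u v) ->
  piecewise_continuous f -> piecewise_continuous g ->
  piecewise_continuous (fun t => h (f t) (g t)).
Proof.
move=> ch /piecewise_continuousP[flr fab] /piecewise_continuousP[glr gab].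
apply/piecewise_continuousP; split=> [t|a b ab].
  have [/cvg_ex[/= fr tfr] /cvg_ex[/= fl tfl]] := flr t.
  have [/cvg_ex[/= gr tgr] /cvg_ex[/= gl tgl]] := glr t.
  split; apply/cvg_ex; [exists (h fr gr)|exists (h fl gl)]; exact: ch.
apply: filterS2 (fab a b ab) (gab a b ab) => t ft gt; exact: ch.
Qed.

Lemma piecewise_continuous_mulmx (m n p : nat) (f : R -> 'M[R]_(m, n))
    (g : R -> 'M[R]_(n, p)) :
  piecewise_continuous f -> piecewise_continuous g ->
  piecewise_continuous (fun t => f t *m g t).
Proof.
by apply: piecewise_continuous_map2 => F FF u v fu gv; exact: cvg_mulmx.
Qed.

Lemma piecewise_continuousD (V : normedModType R) (f g : R -> V) :
  piecewise_continuous f -> piecewise_continuous g ->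
  piecewise_continuous (fun t => f t + g t).
Proof. by apply: piecewise_continuous_map2 => F FF u v fu gv; exact: cvgD. Qed.

Lemma piecewise_continuousN (V : normedModType R) (f : R -> V) :
  piecewise_continuous f -> piecewise_continuous (fun t => - f t).
Proof.
move=> pf; apply: (@piecewise_continuous_map2 V V V (fun x _ => - x) f f) => //.
by move=> F FF u v fu gv; exact: cvgN.
Qed.

Lemma piecewise_continuousZ (V : normedModType R) (k : R -> R) (f : R -> V) :
  piecewise_continuous (k : R -> R^o) -> piecewise_continuous f ->
  piecewise_continuous (fun t => k t *: f t).
Proof.
apply: (@piecewise_continuous_map2 R^o V V (fun x y => x *: y)) => F FF u v.
exact: cvgZ.
Qed.

Lemma piecewise_continuous_trmx (m n : nat) (f : R -> 'M[R]_(m, n)) :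
  piecewise_continuous f -> piecewise_continuous (fun t => (f t)^T).
Proof.
move=> pf; apply: (@piecewise_continuous_map2 _ _ _ (fun x _ => x^T) f f) => //.
by move=> F FF u v fu gv; exact: cvg_trmx.
Qed.

Lemma piecewise_continuous_mxtrace (n : nat) (f : R -> 'M[R]_n) :
  piecewise_continuous f -> piecewise_continuous (fun t => \tr (f t) : R^o).
Proof.
move=> pf.
apply: (@piecewise_continuous_map2 _ _ R^o (fun x _ => \tr x) f f) => //.
move=> F FF u v /cvg_mxP fu _; apply: cvg_big => [|i _]; last exact: fu.
exact: add_continuous.
Qed.

End PiecewiseContinuousAlgebra.

(** * Primitives of bounded functions continuous off finitely many points *)

Section Primitive.
Context {R : realType}.

(** A bounded measurable function is integrable on a segment. Measurability holds on the open set
    left by the exceptional points, and trivially on a finite set. *)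
Lemma almost_continuous_integrable (g : R -> R) (a b K : R) :
  (forall t, t \in `[a, b] -> `|g t| <= K) ->
  (\forall t \near almost a b, {for (t : R), continuous g}) ->
  lebesgue_measure.-integrable `[a, b] (EFin \o g).
Proof.
move=> gK [s gs]; apply: measurable_bounded_integrable => //.
- rewrite [ltLHS](lebesgue_measure_itv `[a, b])/=.
  by case: ifP => // _; rewrite -EFinB ltry.
(* The endpoints join the exceptional points, so that what remains of the segment is open. *)
- pose N : set R := [set` a :: b :: s].
  have fN : finite_set N by exact: finite_seq.
  have mN : measurable N.
    by apply: countable_measurable => //; exact: finite_set_countable.
  have mabN : measurable (`]a, b[ `\` N) by exact: measurableD.
  apply: (@measurable_funS _ _ _ _ ((`]a, b[ `\` N) `|` N)).
  + exact: measurableU.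
  + move=> t /=; rewrite in_itv/=; have [tN|tN] := boolP (t \in a :: b :: s); first by right.
    move=> /andP[at_ tb]; left; split; last exact/negP.
    move: tN; rewrite !inE !negb_or => /and3P[ta tb' _].
    suff : t \in `]a, b[ by [].
    by rewrite in_itv/= !lt_neqAle eq_sym ta at_ tb' tb.
  + apply/measurable_funU => //; split.
      apply: open_continuous_measurable_fun.
        apply: openI; first exact: interval_open.
        apply: closed_openC; apply: (@accessible_finite_set_closed R).1 _ _ fN.
        apply: hausdorff_accessible; exact: Rhausdorff.
      move=> t; rewrite inE => -[tab /negP]; rewrite !inE !negb_or => /and3P[_ _ ts].
      exact: gs.
    move=> mN' Y mY; apply: countable_measurable => //.
    by apply: sub_countable (finite_set_countable fN); apply: subset_card_le => ? [].
- exists K; split; first exact: num_real.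
  by move=> M KM t /= tab; rewrite (le_trans (gK t tab))// ltW.
Qed.

(** The fundamental theorem of calculus applies at each interior point of continuity. The primitive
    is normalised at [b] because the adjoint equation is solved backwards from there. *)
Lemma almost_primitive (g : R -> R) (a b K : R) : a < b ->
  (forall t, t \in `[a, b] -> `|g t| <= K) ->
  (\forall t \near almost a b, {for (t : R), continuous g}) ->
  exists G : R -> R, [/\ {within `[a, b], continuous G}, G b = 0 &
    \forall t \near almost a b, is_derive (t : R) 1 G (g t)].
Proof.
move=> ab gK gc; have ig := almost_continuous_integrable gK gc.
pose J x := (\int[lebesgue_measure]_(t in `[a, x]) g t)%R.
have cJ : {within `[a, b], continuous J}.
  exact: parameterized_integral_continuous (ltW ab) ig.
exists (fun x => J x - J b); split; last 1 first.
- move: gc; apply: filterS2 (almost_inner a b) => t.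
  rewrite /= in_itv/= => /andP[at_ tb] gt.
  have [dJ Jt] := continuous_FTC1_closed tb ig at_ gt.
  have Jd : is_derive t 1 J (g t).
    by apply: DeriveDef; [exact: dJ|rewrite -derive1E; exact: Jt].
  have -> : g t = g t - 0 by rewrite subr0.
  exact: (@is_deriveB _ _ _ J (cst (J b))).
- by move=> x; apply: continuousB; [exact: cJ|exact: cst_continuous].
- by rewrite subrr.
Qed.

End Primitive.

(** * Matrix-valued functions continuous on a closed interval *)

Section WithinContinuous.
Context {R : realType}.
Implicit Types a b : R.

Lemma within_continuous_bounded {V : normedModType R} (f : R -> V) a b :
  {within `[a, b], continuous f} ->
  exists2 K : R, 0 < K & forall t, t \in `[a, b] -> `|f t| <= K.
Proof.
move=> cf; have := compact_bounded (continuous_compact cf (@segment_compact R a b)).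
move=> /ex_strict_bound_gt0[K K0 fK]; exists K => // t tab.
by apply/ltW/fK; exists t.
Qed.

Lemma within_continuous_inner {V : normedModType R} (f : R -> V) a b t :
  {within `[a, b], continuous f} -> t \in `]a, b[ -> {for t, continuous f}.
Proof.
move=> cf tab; have ab : a < b by move: tab; rewrite in_itv/= => /andP[/lt_trans]; exact.
by have [+ _ _] := (continuous_within_itvP _ ab).1 cf; exact.
Qed.

Lemma within_continuous_mulmx {m n p : nat} (A : set R) (f : R -> 'M[R]_(m, n))
    (g : R -> 'M[R]_(n, p)) :
  {within A, continuous f} -> {within A, continuous g} ->
  {within A, continuous (fun t => f t *m g t)}.
Proof. by move=> cf cg t; apply: cvg_mulmx; [exact: cf|exact: cg]. Qed.

Lemma within_continuous_trmx {m n : nat} (A : set R) (f : R -> 'M[R]_(m, n)) :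
  {within A, continuous f} -> {within A, continuous (fun t => (f t)^T)}.
Proof. by move=> cf t; apply: cvg_trmx; exact: cf. Qed.

Lemma almost_norm_mx_derive_le {m n : nat} a b (f df : R -> 'M[R]_(m, n))
    (g dg : R -> R) :
  {within `[a, b], continuous f} -> {within `[a, b], continuous g} ->
  (\forall t \near almost a b, [/\ is_derive (t : R) 1 f (df t),
     is_derive (t : R) 1 g (dg t) & `|df t| <= - dg t]) ->
  f b = 0 -> 0 <= g b -> forall t, t \in `[a, b] -> `|f t| <= g t.
Proof.
move=> cf cg dfg fb0 gb0 t tab.
(* The matrix norm is a maximum taken from 0, so entrywise bounds alone do not suffice; comparison
   with the zero function supplies the sign of [g]. *)
have g0 : 0 <= g t.
  rewrite -(@normr0 _ R); apply: (@almost_norm_derive_le _ a b (cst 0) (cst 0) g dg) => //.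
  - by move=> x; exact: cst_continuous.
  - apply: filterS dfg => x [_ dg_ le]; split => //; first exact: is_derive_cst.
    by rewrite normr0 (le_trans _ le).
rewrite [leLHS]/Num.Def.normr/= mx_normrE bigmax_le//= => -[i j] _ /=.
apply: (@almost_norm_derive_le _ a b (fun s => f s i j) (fun s => df s i j) g dg) => //.
- by move=> x; move: (cf x) => /cvg_mxP; exact.
- apply: filterS dfg => x [/is_derive_mxP df_ dg_ le]; split => //.
  exact: le_trans (norm_mx_entry_le _ _ _) le.
- by rewrite fb0 mxE.
Qed.

Lemma almost_primitive_mx {m n : nat} (g : R -> 'M[R]_(m, n)) a b K : a < b ->
  (forall t, t \in `[a, b] -> `|g t| <= K) ->
  (\forall t \near almost a b, {for (t : R), continuous g}) ->
  exists G : R -> 'M[R]_(m, n), [/\ {within `[a, b], continuous G}, G b = 0 &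
    \forall t \near almost a b, is_derive (t : R) 1 G (g t)].
Proof.
move=> ab gK gc.
have /choice[G GP] : forall ij : 'I_m * 'I_n, exists G : R -> R,
    [/\ {within `[a, b], continuous G}, G b = 0 &
    \forall t \near almost a b, is_derive (t : R) 1 G (g t ij.1 ij.2)].
  move=> ij; apply: (@almost_primitive _ _ a b K) => //.
    by move=> t tab; exact: le_trans (norm_mx_entry_le _ _ _) (gK t tab).
  by apply: filterS gc => t /cvg_mxP; exact.
exists (fun t => \matrix_(i, j) G (i, j) t); split.
- move=> t; apply/cvg_mxP => i j; rewrite mxE; under eq_cvg do rewrite mxE.
  by have [cG _ _] := GP (i, j); exact: cG.
- by apply/matrixP => i j; rewrite !mxE; have [_ ->] := GP (i, j).
- have : \forall t \near almost a b, forall ij : 'I_m * 'I_n,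
      is_derive (t : R) 1 (G ij) (g t ij.1 ij.2).
    by apply: filter_forall => ij; have [] := GP ij.
  apply: filterS => t dG; apply/is_derive_mxP => i j.
  by under eq_fun do rewrite mxE; exact: (dG (i, j)).
Qed.

End WithinContinuous.

(** * Linear differential equations with piecewise continuous coefficients *)

Section LinearODE.
Context {R : realType} {n : nat}.
Variables (N : R -> 'M[R]_n) (a b : R) (w : 'cV[R]_n).
Hypotheses (ab : a < b) (pcN : piecewise_continuous N).

Let picard (x y : R -> 'cV[R]_n) :=
  [/\ {within `[a, b], continuous y}, y b = w &
      \forall t \near almost a b, is_derive (t : R) 1 y (N t *m x t)].

Let ex_picard x : {within `[a, b], continuous x} -> exists y, picard x y.
Proof.
move=> cx.
have [KN KN0 NK] := piecewise_continuous_bounded a b pcN.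
have [Kx Kx0 xK] := within_continuous_bounded cx.
have [t tab||G [cG Gb dG]] := @almost_primitive_mx _ _ _ (fun t => N t *m x t) _ _
    (n%:R * KN * Kx) ab.
- rewrite (le_trans (norm_mulmx_le _ _))// ler_pM ?mulr_ge0//; last exact: xK.
  by rewrite ler_wpM2l//; exact: NK.
- have := piecewise_continuous_almost a b pcN.
  apply: filterS2 (almost_inner a b) => t tab Nt.
  by apply: cvg_mulmx => //; exact: within_continuous_inner cx tab.
exists (fun t => w + G t); split.
- by move=> t; apply: cvgD; [exact: cst_continuous|exact: cG].
- by rewrite Gb addr0.
- by apply: filterS dG => t Gt; rewrite -[X in is_derive _ _ _ X]add0r; exact: is_deriveD.
Qed.

(* With the weight [expR (2 * K * (b - t))], where [K] bounds the operator norm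
   of [N] on [[a, b]], one Picard step halves the distance. *)
Let picard_contracts : exists2 e : R -> R,
  (forall t, t \in `[a, b] -> 1 <= e t <= e a) &
  forall x x' y y' C, picard x y -> picard x' y' ->
    (forall t, t \in `[a, b] -> `|x t - x' t| <= C * e t) ->
    forall t, t \in `[a, b] -> `|y t - y' t| <= C / 2 * e t.
Proof.
have [K K0 NK] : exists2 K : R, 0 <= K &
    forall t, t \in `[a, b] -> forall v : 'cV_n, `|N t *m v| <= K * `|v|.
  have [KN KN0 NK] := piecewise_continuous_bounded a b pcN.
  exists (n%:R * KN) => [|t tab v]; first by rewrite mulr_ge0// ltW.
  rewrite (le_trans (norm_mulmx_le _ _))// ler_wpM2r// ler_wpM2l//.
  exact: NK.
exists (fun t => expR (2 * K * (b - t))).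
  move=> t; rewrite in_itv/= => /andP[at_ tb].
  apply/andP; split; first by rewrite -expR0 ler_expR !mulr_ge0// subr_ge0.
  by rewrite ler_expR; apply: ler_wpM2l; rewrite ?mulr_ge0// lerB.
move=> x x' y y' C [cy yb dy] [cy' y'b dy'] xx'.
pose e t := expR (2 * K * (b - t)).
(* The weight makes the decay rate of the majorant equal to the bound [K * (C * e t)] on the
   difference of the two right-hand sides. *)
have de (t : R) : is_derive t 1 (fun s => C / 2 * e s) (- (K * (C * e t))).
  have d1 : is_derive t 1 (fun s : R => 2 * K * (b - s)) (- (2 * K)).
    have db : is_derive t 1 (cst b \- id) (0 - 1) by exact: is_deriveB.
    have := @is_deriveZ _ _ _ (cst b \- id) (2 * K) t 1 _ db.
    by rewrite sub0r /GRing.scale/= mulrN1.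
  have d2 : is_derive t 1 e (- (2 * K) * e t).
    rewrite [X in is_derive _ _ _ X]mulrC.
    exact: (@is_derive1_comp R expR (fun s => 2 * K * (b - s)) t _ _ (is_derive_expR _) d1).
  have := @is_deriveZ _ _ _ e (C / 2) t 1 _ d2.
  by rewrite /GRing.scale/= => /is_derive_eq; apply; field.
apply: (@almost_norm_mx_derive_le _ _ _ a b (fun t => y t - y' t)
  (fun t => N t *m x t - N t *m x' t)
  (fun t => C / 2 * e t) (fun t => - (K * (C * e t)))).
- by move=> t; apply: cvgB; [exact: cy|exact: cy'].
- apply: derivable_within_continuous => t _.
  by have [] := de t.
- apply: filterS3 (almost_inner a b) dy dy' => t tab dyt dyt'.
  have tab' : t \in `[a, b] by exact: subset_itv_oo_cc.
  split => //; first exact: is_deriveB.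
  by rewrite opprK -mulmxBr (le_trans (NK _ tab' _))// ler_wpM2l// xx'.
- by rewrite yb y'b subrr.
- have bab : b \in `[a, b] by rewrite in_itv/= lexx (ltW ab).
  (* The sign of [C] is read off at [b], where [C * e b] bounds a norm. *)
  by rewrite mulr_ge0 ?expR_ge0// divr_ge0// -(@pmulr_lge0 _ (e b)) ?expR_gt0// (le_trans _ (xx' b bab)).
Qed.

(** Picard iteration from the constant [w]: the iterates converge uniformly in the weighted norm,
    and their limit is a fixed point on the segment. *)
Lemma linear_ode_backward : exists y : R -> 'cV[R]_n,
  [/\ {within `[a, b], continuous y}, y b = w &
      \forall t \near almost a b, is_derive (t : R) 1 y (N t *m y t)].
Proof.
have [e e1 contr] := picard_contracts.
(* The Picard step becomes a total map, with a dummy value at discontinuous arguments. *)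
have /choice[J JP] : forall x, exists y, {within `[a, b], continuous x} -> picard x y.
  move=> x; have [/ex_picard[y xy]|ncx] := pselect {within `[a, b], continuous x}.
    by exists y.
  by exists x.
pose X k := iter k J (cst w).
have cX k : {within `[a, b], continuous (X k)}.
  by elim: k => [|k IH]; [move=> t; exact: cst_continuous|have [] := JP _ IH].
have pX k : picard (X k) (X k.+1) by exact: JP.
have [C C0 XC] : exists2 C, 0 < C & forall t, t \in `[a, b] -> `|X 1%N t - X 0%N t| <= C.
  have := @within_continuous_bounded R _ (fun t => X 1%N t - X 0%N t) a b.
  by apply => t; apply: cvgB; [exact: (cX 1%N)|exact: (cX 0%N)].
have e0 t : t \in `[a, b] -> 0 <= e t.
  by move=> /e1/andP[+ _]; exact: le_trans.
have step k t : t \in `[a, b] -> `|X k.+1 t - X k t| <= C * 2^-1 ^+ k * e t.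
  elim: k t => [|k IH] t tab.
    rewrite expr0 mulr1 (le_trans (XC t tab))// ler_peMr ?(ltW C0)//.
    by have /andP[] := e1 t tab.
  by rewrite exprSr mulrA; exact: contr (pX k.+1) (pX k) IH t tab.
have tail k l t : t \in `[a, b] ->
    `|X (k + l)%N t - X k t| <= 2 * C * 2^-1 ^+ k * e t.
  move=> tab.
  (* The exact partial sum of the geometric series is what makes the induction on [l] go through. *)
  have : `|X (k + l)%N t - X k t| <= 2 * C * 2^-1 ^+ k * (1 - 2^-1 ^+ l) * e t.
    elim: l => [|l IH]; first by rewrite addn0 subrr normr0 expr0 subrr mulr0 mul0r.
    rewrite -(subrKA (X (k + l)%N t)) (le_trans (ler_normD _ _))//.
    rewrite addnS (le_trans (lerD (step _ _ tab) IH))// exprD exprS.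
    by rewrite le_eqVlt; apply/predU1P; left; field.
  move=> /le_trans; apply; rewrite ler_wpM2r ?e0// ler_piMr//.
    by rewrite !mulr_ge0 ?exprn_ge0 ?ltW.
have small (M eps : R) : 0 < eps -> exists k, M * 2^-1 ^+ k < eps.
  move=> eps0.
  have : M * 2^-1 ^+ k @[k --> \oo] --> M * 0.
    by apply: cvgMl_tmp; apply: cvg_expr; rewrite ger0_norm ?invf_lt1 ?ltr1n.
  rewrite mulr0 => /cvgrPdist_lt/(_ _ eps0)[k _ /(_ k (leqnn k))] /=.
  rewrite sub0r normrN => kM; exists k; exact: le_lt_trans (ler_norm _) kM.
have cvgX t : t \in `[a, b] -> cvg (X k t @[k --> \oo]).
  move=> tab; apply/cauchy_cvgP/cauchy_exP => eps eps0.
  have [k kM] := small (2 * C * e t) _ eps0.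
  exists (X k t); exists k => // m /= km.
  rewrite -ball_normE/= distrC (le_lt_trans _ kM)// -(subnKC km).
  by rewrite (le_trans (tail _ _ _ tab))// mulrAC.
pose x t := lim (X k t @[k --> \oo]).
have xX k t : t \in `[a, b] -> `|x t - X k t| <= 2 * C * 2^-1 ^+ k * e t.
  move=> tab; have cx : X m t @[m --> \oo] --> x t by exact: cvgX.
  have : `|X m t - X k t| @[m --> \oo] --> `|x t - X k t|.
    by apply: cvg_norm; apply: cvgB => //; exact: cvg_cst.
  move=> /cvgr_to_le; apply; exists k => // m /= km.
  by rewrite -(subnKC km) tail.
have aab : a \in `[a, b] by rewrite in_itv/= lexx (ltW ab).
(* A uniform limit of continuous functions: as [e] is at most [e a], one index [k] serves all
   times. *)
have cx : {within `[a, b], continuous x}.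
  apply/subspace_continuousP => t tab; apply/cvgrPdist_lt => eps eps0.
  have [|k kM] := small (2 * C * e a) (eps / 3); first by rewrite divr_gt0.
  have unif s : s \in `[a, b] -> `|x s - X k s| < eps / 3.
    move=> sab; apply: le_lt_trans kM; rewrite (le_trans (xX k s sab))//.
    rewrite [leRHS]mulrAC; apply: ler_wpM2l; last by have /andP[] := e1 s sab.
    by rewrite !mulr_ge0 ?exprn_ge0 ?(ltW C0).
  have /subspace_continuousP/(_ t tab)/cvgrPdist_lt := cX k.
  have eps3 : 0 < eps / 3 by rewrite divr_gt0.
  move=> /(_ _ eps3); rewrite !near_withinE; apply: filterS => s Xs sab.
  have -> : x t - x s = (x t - X k t) + ((X k t - X k s) + (X k s - x s)).
    by rewrite !addrA subrK subrK.
  have := unif s sab; have := unif t tab; rewrite (distrC (x s)).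
  have := ler_normD (x t - X k t) ((X k t - X k s) + (X k s - x s)).
  have := ler_normD (X k t - X k s) (X k s - x s).
  have : `|X k t - X k s| < eps / 3 := Xs sab.
  lra.
have py := JP x cx; have [cy yb dy] := py.
(* [J x] is differentiable by construction, whereas the limit [x] is so far only continuous; it
   remains to identify the two on the segment. *)
exists (J x); split => //.
have yx t : t \in `[a, b] -> J x t = x t.
  move=> tab; apply/eqP; rewrite -subr_eq0 -normr_le0.
  apply/ler_addgt0Pr => eps eps0; rewrite add0r.
  have [k kM] := small (2 * C * e t) eps eps0.
  rewrite -(subrKA (X k.+1 t)) (le_trans (ler_normD _ _))// (le_trans _ (ltW kM))//.
  (* Contraction and the tail estimate at [k.+1] each contribute at most [C * 2^-1 ^+ k * e t],
     which add up to the quantity in [kM]. *)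
  have := contr _ _ _ _ _ py (pX k) (fun s => xX k s) t tab.
  have := xX k.+1 t tab; rewrite distrC exprS.
  lra.
apply: filterS2 (almost_inner a b) dy => t tab.
by rewrite yx//; exact: subset_itv_oo_cc.
Qed.

End LinearODE.

(** * Exponential growth estimates and forward uniqueness *)

Section Growth.
Context {R : realType}.

(** With the integrating factor [expR (K * t)] the derivative becomes nonnegative. The sign of [K]
    is free: a negative [K] applied to [- E] gives the usual upper bound of Gronwall type. *)
Lemma exp_growth_le (a b K : R) (E dE : R -> R) : a <= b ->
  {within `[a, b], continuous E} ->
  (\forall t \near almost a b, is_derive (t : R) 1 E (dE t) /\ - K * E t <= dE t) ->
  E a * expR (K * a) <= E b * expR (K * b).
Proof.
move=> ab cE dEP.
have de (t : R) : is_derive t 1 (fun s => expR (K * s)) (K * expR (K * t)).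
  rewrite [X in is_derive _ _ _ X]mulrC.
  have d1 : is_derive t 1 (fun s : R => K * s) K.
    have := @is_deriveZ _ _ _ (@id R) K t 1 _ (is_derive_id _ _).
    by rewrite /GRing.scale/= mulr1.
  exact: (@is_derive1_comp R expR (fun s => K * s) t _ _ (is_derive_expR _) d1).
apply: (@almost_ger0_derive_le _ a b (fun t => E t * expR (K * t))
  (fun t => E t *: (K * expR (K * t)) + expR (K * t) *: dE t)) => //.
  have ce : {within `[a, b], continuous (fun s : R => expR (K * s))}.
    by apply: derivable_within_continuous => t _; have [] := de t.
  by move=> t; apply: cvgM; [exact: cE|exact: ce].
apply: filterS dEP => t [dEt le]; split; first exact: is_deriveM.
rewrite /GRing.scale/=.
have -> : E t * (K * expR (K * t)) + expR (K * t) * dE t =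
  expR (K * t) * (dE t - - K * E t) by ring.
by rewrite mulr_ge0 ?expR_ge0// subr_ge0.
Qed.

Lemma linear_ode_eq0 {n : nat} (a b : R) (N : R -> 'M[R]_n) (y : R -> 'cV[R]_n) :
  a <= b -> piecewise_continuous N -> {within `[a, b], continuous y} ->
  (\forall t \near almost a b, is_derive (t : R) 1 y (N t *m y t)) ->
  y a = 0 -> y b = 0.
Proof.
move=> ab pcN cy dy ya0.
have [K K0 NK] := piecewise_continuous_bounded a b pcN.
(* The squared Euclidean norm, unlike the maximum norm, is differentiable along [y]. *)
pose E t := (((y t)^T *m y t) 0 0).
have EE t : E t = \sum_i y t i 0 ^+ 2.
  by rewrite /E mxE; apply: eq_bigr => i _; rewrite mxE expr2.
have E0 t : 0 <= E t by rewrite EE sumr_ge0// => i _; exact: sqr_ge0.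
have cE : {within `[a, b], continuous (fun t => - E t)}.
  have cyy := within_continuous_mulmx (within_continuous_trmx cy) cy.
  move=> t; apply: cvgN; move: (cyy t) => /cvg_mxP; exact.
pose k := 2 * (n%:R * K).
have : - E a * expR (- k * a) <= - E b * expR (- k * b).
  apply: (@exp_growth_le a b (- k) (fun t => - E t)
    (fun t => - (((N t *m y t)^T *m y t + (y t)^T *m (N t *m y t)) 0 0))) => //.
  apply: filterS2 (almost_inner a b) dy => t tab yt; split.
    apply: is_deriveN.
    have /is_derive_mxP := is_derive_mulmx (is_derive_trmx yt) yt; exact.
  rewrite opprK mulrN lerN2 [leLHS]mxE.
  have -> : ((N t *m y t)^T *m y t) 0 0 = ((y t)^T *m (N t *m y t)) 0 0.
    by transitivity (((N t *m y t)^T *m y t)^T 0 0); [rewrite [RHS]mxE|rewrite trmx_mul trmxK].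
  set z := (X in X + X); suff : z <= n%:R * K * E t by rewrite /k; lra.
  (* The inequality between arithmetic and geometric means; summing over all pairs of indices gives
     the factor [n%:R * K]. *)
  have le_z i j : y t i 0 * (N t i j * y t j 0) <= K * ((y t i 0 ^+ 2 + y t j 0 ^+ 2) / 2).
    have Nij : `|N t i j| <= K.
      exact: le_trans (norm_mx_entry_le _ _ _) (NK t (subset_itv_oo_cc tab)).
    rewrite mulrCA (le_trans (ler_norm _))// normrM ler_pM//.
    have := sqr_ge0 (y t i 0 - y t j 0); have := sqr_ge0 (y t i 0 + y t j 0).
    rewrite ler_norml => ? ?; apply/andP; split; nra.
  have sum_l : \sum_(i < n) \sum_(j < n) y t i 0 ^+ 2 = n%:R * E t.
    rewrite EE mulr_sumr; apply: eq_bigr => i _.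
    by rewrite sumr_const card_ord mulr_natl.
  have sum_r : \sum_(i < n) \sum_(j < n) y t j 0 ^+ 2 = n%:R * E t.
    by rewrite -EE sumr_const card_ord mulr_natl.
  have -> : n%:R * K * E t = \sum_(i < n) \sum_(j < n) K * ((y t i 0 ^+ 2 + y t j 0 ^+ 2) / 2).
    transitivity (K / 2 * (n%:R * E t + n%:R * E t)); first by field.
    rewrite -{1}sum_l -sum_r -big_split/= mulr_sumr; apply: eq_bigr => i _.
    by rewrite -big_split/= mulr_sumr; apply: eq_bigr => j _; rewrite mulrA mulrAC.
  rewrite /z mxE; apply: ler_sum => i _; rewrite [in leLHS]mxE [in leLHS]mxE mulr_sumr.
  by apply: ler_sum => j _; exact: le_z.
have -> : E a = 0 by rewrite /E ya0 mulmx0 mxE.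
rewrite oppr0 mul0r mulNr oppr_ge0 pmulr_lle0 ?expR_gt0// => Eb0.
have {}Eb0 : E b = 0 by apply/eqP; rewrite eq_le Eb0 E0.
apply/matrixP => i j; rewrite ord1 mxE; apply/eqP; rewrite -sqrf_eq0; apply/eqP.
move: Eb0; rewrite EE => /eqP; rewrite psumr_eq0 => [/allP/(_ i)|k' _]; last exact: sqr_ge0.
by rewrite mem_index_enum => /(_ isT)/eqP.
Qed.

End Growth.

(** * Minimising the ratio of two quadratic forms *)

Section QuadraticForms.
Context {R : realType} {n : nat}.
Implicit Types (M Q : 'M[R]_n) (v : 'cV[R]_n).

(** The constant is minus the minimum of the Rayleigh quotient of [Q] by [M], and [w] is a
    minimiser. The quotient is homogeneous of degree 0, so the compact unit sphere suffices; it is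
    negative at [v], so [c] is positive. *)
Lemma pencil_min Q M v : posdef M -> (v^T *m Q *m v) 0 0 < 0 ->
  exists2 c : R, 0 < c & exists w : 'cV[R]_n,
    [/\ w != 0, (w^T *m (Q + c *: M) *m w) 0 0 = 0 &
        forall u : 'cV[R]_n, 0 <= (u^T *m (Q + c *: M) *m u) 0 0].
Proof.
move=> [_ M0] Qv.
pose q A (u : 'cV[R]_n) := (u^T *m A *m u) 0 0.
have qZ A (k : R) u : q A (k *: u) = k ^+ 2 * q A u.
  by rewrite /q -scalemxAr [(k *: u)^T]linearZ/= -!scalemxAl scalerA mxE expr2.
have qP c u : q (Q + c *: M) u = q Q u + c * q M u.
  by rewrite /q mulmxDr mulmxDl mxE -scalemxAr -scalemxAl [in X in _ + X]mxE.
(* Row vectors suit [bounded_closed_compact] and [EVT_min_rV]. *)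
pose f (u : 'rV[R]_n) := q Q u^T / q M u^T.
pose S := [set u : 'rV[R]_n | `|u| = 1].
have unit_S (u : 'cV[R]_n) : u != 0 -> S (`|u^T|^-1 *: u^T).
  move=> u0; have uT0 : u^T != 0 by rewrite -(inj_eq trmx_inj) trmxK trmx0.
  by rewrite /S/= normrZ normfV normr_id mulVf// normr_eq0.
have v0 : v != 0 by apply: contraTneq Qv => ->; rewrite mulmx0 mxE ltxx.
have cS : compact S.
  apply: bounded_closed_compact.
    exists 1; split; first exact: num_real.
    by move=> x x1 u /= ->; exact: ltW.
  apply: (@closed_comp _ _ (fun u : 'rV[R]_n => `|u|) [set 1]); last exact: closed_eq.
  by move=> u _; exact: norm_continuous.
have S_neq0 (u : 'rV[R]_n) : S u -> u^T != 0.
  move=> u1; rewrite -(inj_eq trmx_inj) trmxK trmx0 -normr_eq0 u1.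
  exact: oner_neq0.
have cf : {within S, continuous f}.
  apply: continuous_in_subspaceT => u; rewrite inE => /S_neq0 u0.
  have cq A : {for u, continuous (fun u : 'rV[R]_n => q A u^T)}.
    have ct : x^T @[x --> u] --> u^T by apply: (@cvg_trmx _ _ (nbhs u) _ _ _ id u) => P.
    have cm : x^T^T *m A *m x^T @[x --> u] --> u^T^T *m A *m u^T.
      apply: (@cvg_mulmx _ _ (nbhs u)); last exact: ct.
      by apply: (@cvg_mulmx _ _ (nbhs u)); [exact: (@cvg_trmx _ _ (nbhs u))|exact: cvg_cst].
    by move/cvg_mxP : cm; exact.
  apply: (@cvgM _ _ (nbhs u) _ (fun x => q Q x^T) (fun x => (q M x^T)^-1)); first exact: cq.
  by apply: cvgV; [rewrite gt_eqF// M0|exact: cq].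
have [|u] := EVT_min_rV _ cS cf; first by exists (`|v^T|^-1 *: v^T); exact: unit_S.
rewrite inE => Su fmin; have u0 := S_neq0 u Su.
have fE (k : 'cV[R]_n) : k != 0 -> f (`|k^T|^-1 *: k^T) = q Q k / q M k.
  move=> k0; rewrite /f linearZ/= trmxK !qZ -mulf_div divff ?mul1r//.
  by rewrite sqrf_eq0 invr_eq0 normr_eq0 -(inj_eq trmx_inj) trmxK trmx0.
exists (- f u).
  rewrite oppr_gt0 (le_lt_trans (fmin (`|v^T|^-1 *: v^T) _)) ?inE//.
    exact: unit_S.
  by rewrite fE// ltr_pdivrMr ?mul0r// M0.
exists u^T; split => // [|k].
  rewrite -/(q _ _) qP mulNr /f divfK ?subrr// gt_eqF//; exact: M0.
have [->|k0] := eqVneq k 0; first by rewrite mulmx0 mxE.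
have := fmin (`|k^T|^-1 *: k^T); rewrite inE => /(_ (unit_S k k0)).
by rewrite fE// ler_pdivlMr ?M0// -/(q _ _) qP mulNr subr_ge0.
Qed.

End QuadraticForms.

(** * The gap between two ellipsoids *)

Section Identities.
Context {R : realType}.

Lemma mulmx_trl_eq0 {m : nat} (x : 'cV[R]_m) : (x^T *m x) 0 0 = 0 -> x = 0.
Proof.
rewrite mxE => /eqP; rewrite psumr_eq0 => [/allP x0|i _]; last first.
  by rewrite mxE -expr2 sqr_ge0.
apply/matrixP => i j; rewrite ord1 mxE; apply/eqP; rewrite -sqrf_eq0.
by have := x0 i (mem_index_enum i); rewrite mxE -expr2.
Qed.

Lemma mulmx_trl_ge0 {m : nat} (x : 'cV[R]_m) : 0 <= (x^T *m x) 0 0.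
Proof. by rewrite mxE sumr_ge0// => i _; rewrite mxE -expr2 sqr_ge0. Qed.

Lemma observer_noise_gram {n m p : nat} (B : 'M[R]_(n, m)) (D : 'M[R]_(p, m))
    (L : 'M[R]_(n, p)) : D *m B^T = 0 -> D *m D^T = 1%:M ->
  (B + L *m D) *m (B + L *m D)^T = B *m B^T + L *m L^T.
Proof.
move=> DB DD.
have BD : B *m D^T = 0 by rewrite -(trmxK B) -trmx_mul DB trmx0.
rewrite raddfD/= trmx_mul mulmxDl !mulmxDr -!mulmxA DB mulmx0 add0r.
by rewrite (mulmxA D) DD mul1mx (mulmxA B) BD mul0mx addr0.
Qed.

(** Completing the square: the cross terms of [G *m G^T] turn [A] into [AL] in the equation for [P],
    and its last term absorbs the quadratic one. The multiple [c *: PL] brings in its own forcing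
    term; [c = 0] is the bare gap. *)
Lemma lyapunov_gap {n m p : nat} (A P PL : 'M[R]_n) (B : 'M[R]_(n, m))
    (C : 'M[R]_(p, n)) (D : 'M[R]_(p, m)) (L : 'M[R]_(n, p)) (al c : R) :
  al != 0 -> P^T = P -> D *m B^T = 0 -> D *m D^T = 1%:M ->
  let AL := A + L *m C in
  let BL := B + L *m D in
  let F := AL + al *: (2^-1)%:M in
  let G := L + al *: (P *m C^T) in
  let dPL := AL *m PL + PL *m AL^T + al *: PL + al^-1 *: (BL *m BL^T) in
  let dP := A *m P + P *m A^T + al *: P + al^-1 *: (B *m B^T)
            - al *: (P *m C^T *m C *m P) in
  let S := PL - P + c *: PL in
  dPL - dP + c *: dPL =
  F *m S + S *m F^T + al^-1 *: (G *m G^T + c *: (BL *m BL^T)).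
Proof.
move=> al0 PT DB DD AL BL F G dPL dP S.
have BLE : BL *m BL^T = B *m B^T + L *m L^T by exact: observer_noise_gram.
have GE : G *m G^T = L *m L^T + al *: (L *m C *m P) + al *: (P *m (L *m C)^T)
                     + (al * al) *: (P *m C^T *m C *m P).
  rewrite /G raddfD/= linearZ/= !trmx_mul trmxK PT mulmxDl !mulmxDr.
  by rewrite -!scalemxAl -!scalemxAr !scalerA !mulmxA !addrA.
have FE X : F *m X = AL *m X + al *: (2^-1 *: X).
  by rewrite mulmxDl -scalemxAl mul_scalar_mx.
have FTE X : X *m F^T = X *m AL^T + al *: (2^-1 *: X).
  by rewrite raddfD/= linearZ/= tr_scalar_mx mulmxDr -scalemxAr mul_mx_scalar.
have ALP : A *m P = AL *m P - L *m C *m P by rewrite mulmxDl addrK.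
have PAL : P *m A^T = P *m AL^T - P *m (L *m C)^T by rewrite raddfD/= mulmxDr addrK.
rewrite FE FTE /dPL /dP GE BLE ALP PAL /S.
rewrite !(mulmxDl, mulmxDr, mulmxN, mulNmx) -!scalemxAl -!scalemxAr.
(* The products now enter linearly and may be treated as independent matrices. *)
move: (AL *m PL) (PL *m AL^T) (AL *m P) (P *m AL^T) (L *m C *m P) (P *m (L *m C)^T)
  (P *m C^T *m C *m P) (B *m B^T) (L *m L^T).
move=> X1 X2 X3 X4 X5 X6 X7 X8 X9.
by apply/matrixP => i j; rewrite !mxE; field.
Qed.

End Identities.

Lemma Tperiodic_mulrn {R : realType} {X : Type} (T : R) (f : R -> X) k t :
  Tperiodic T f -> f (t + T *+ k) = f t.
Proof.
by move=> fT; elim: k => [|k IH]; rewrite ?mulr0n ?addr0// mulrSr addrA fT.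
Qed.

Lemma is_derive_vanishing {R : realType} (f : R -> R) (a b t df : R) :
  (forall s, s \in `[a, b] -> f s = 0) -> t \in `]a, b[ ->
  is_derive t 1 f df -> df = 0.
Proof.
move=> f0 tab dft.
have : is_derive t 1 f 0.
  apply: near_eq_is_derive (is_derive_cst (0 : R) t 1).
  near=> s; rewrite f0//; apply: subset_itv_oo_cc.
  near: s; exact: near_in_itvoo.
by move=> d0; rewrite -(@derive_val _ _ _ _ _ _ _ dft) (@derive_val _ _ _ _ _ _ _ d0).
Unshelve. all: by end_near. Qed.

(** * Positive semidefiniteness of the periodic gap *)

Section PeriodicGap.
Context {R : realType} {n m p : nat}.
Variables (T : R) (A : R -> 'M[R]_n) (B : R -> 'M[R]_(n, m))
  (C : R -> 'M[R]_(p, n)) (D : R -> 'M[R]_(p, m)) (alpha : R -> R)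
  (P : R -> 'M[R]_n) (L : R -> 'M[R]_(n, p)) (PL : R -> 'M[R]_n).
Hypotheses (T0 : 0 < T) (pcA : piecewise_continuous A)
  (pcB : piecewise_continuous B) (pcC : piecewise_continuous C)
  (pcD : piecewise_continuous D) (pcL : piecewise_continuous L)
  (pcalpha : piecewise_continuous (alpha : R -> R^o))
  (alpha0 : forall t, 0 < alpha t)
  (DB : forall t, D t *m (B t)^T = 0) (DD : forall t, D t *m (D t)^T = 1%:M)
  (Psol : riccati_sol T A B C alpha P)
  (PLsol : error_ellipsoid T A B C D alpha L PL).

(** The shift by [alpha / 2] splits the term [alpha X] evenly between [F X] and [X F^T]. [G]
    vanishes exactly at the candidate gain, and a positive [c] makes [BL] visible in the forcing
    term [Q]. *)
Let F t := A t + L t *m C t + alpha t *: (2^-1)%:M.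
Let BL t := B t + L t *m D t.
Let G t := L t + alpha t *: (P t *m (C t)^T).
Let S c t := PL t - P t + c *: PL t.
Let Q c t := (alpha t)^-1 *: (G t *m (G t)^T + c *: (BL t *m (BL t)^T)).

Let pcF : piecewise_continuous F.
Proof.
have pcLC := piecewise_continuous_mulmx pcL pcC.
have pccst : piecewise_continuous (fun=> (2^-1)%:M : 'M[R]_n).
  by apply: piecewise_continuous_continuous => t; exact: cst_continuous.
exact: piecewise_continuousD (piecewise_continuousD pcA pcLC)
  (piecewise_continuousZ pcalpha pccst).
Qed.

Let continuousS c : continuous (S c).
Proof.
have [_ _ [cP _]] := Psol; have [_ _ [cPL _]] := PLsol.
move=> t; apply: cvgD; first by apply: cvgB; [exact: cPL|exact: cP].
by apply: cvgZ; [exact: cvg_cst|exact: cPL].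
Qed.

Let almost_continuous_data (a b : R) : \forall t \near almost a b,
  [/\ {for (t : R), continuous A}, {for (t : R), continuous B},
      {for (t : R), continuous C}, {for (t : R), continuous D} &
      {for (t : R), continuous L} /\ {for (t : R), continuous (alpha : R -> R^o)}].
Proof.
have cA := piecewise_continuous_almost a b pcA.
have cB := piecewise_continuous_almost a b pcB.
have cC := piecewise_continuous_almost a b pcC.
have cD := piecewise_continuous_almost a b pcD.
have cL := piecewise_continuous_almost a b pcL.
have calpha := piecewise_continuous_almost a b pcalpha.
by near=> t; split; [near: t|near: t|near: t|near: t|split; near: t].
Unshelve. all: by end_near. Qed.

(** [ode_sol] yields a derivative only where the whole right-hand side is continuous, so that
    continuity is first assembled from the coefficients. *)
Let almost_derive_S c (a b : R) : \forall t \near almost a b,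
  is_derive (t : R) 1 (S c) (F t *m S c t + S c t *m (F t)^T + Q c t).
Proof.
have [_ Ppos [cP dP]] := Psol; have [_ _ [cPL dPL]] := PLsol.
apply: filterS (almost_continuous_data a b) => t [cA cB cC cD [cL calpha]].
have al0 : alpha t != 0 by rewrite gt_eqF.
have PT : (P t)^T = P t by have [] := Ppos t.
have calV := continuousV al0 calpha.
have {}cP := cP t; have {}cPL := cPL t.
have dPt : is_derive t 1 P (A t *m P t + P t *m (A t)^T + alpha t *: P t
    + (alpha t)^-1 *: (B t *m (B t)^T) - alpha t *: (P t *m (C t)^T *m C t *m P t)).
  have cAT := continuous_trmx cA; have cBT := continuous_trmx cB.
  have cCT := continuous_trmx cC.
  have cquad := continuousZ calpha
    (continuous_mulmx (continuous_mulmx (continuous_mulmx cP cCT) cC) cP).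
  have cBB := continuousZ calV (continuous_mulmx cB cBT).
  have cAPA := continuousD (continuous_mulmx cA cP) (continuous_mulmx cP cAT).
  exact: dP (continuousB (continuousD (continuousD cAPA (continuousZ calpha cP)) cBB) cquad).
have dPLt : is_derive t 1 PL ((A t + L t *m C t) *m PL t + PL t *m (A t + L t *m C t)^T
    + alpha t *: PL t + (alpha t)^-1 *: (BL t *m (BL t)^T)).
  have cAL := continuousD cA (continuous_mulmx cL cC).
  have cBL := continuousD cB (continuous_mulmx cL cD).
  have cBB := continuousZ calV (continuous_mulmx cBL (continuous_trmx cBL)).
  have cAPA := continuousD (continuous_mulmx cAL cPL) (continuous_mulmx cPL (continuous_trmx cAL)).
  exact: dPL (continuousD (continuousD cAPA (continuousZ calpha cPL)) cBB).
rewrite -lyapunov_gap//.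
exact: is_deriveD (is_deriveB dPLt dPt) (is_deriveZ c dPLt).
Qed.


(* Along a solution of the adjoint equation the form of [S] cannot decrease;
   if it vanishes at the right end, then the forcing term [Q] is invisible. *)
Let adjoint_kernel c (a b : R) (eta : R -> 'cV[R]_n) : a < b -> 0 < c ->
  (forall v : 'cV_n, 0 <= (v^T *m S c a *m v) 0 0) ->
  {within `[a, b], continuous eta} ->
  (\forall t \near almost a b, is_derive (t : R) 1 eta (- (F t)^T *m eta t)) ->
  ((eta b)^T *m S c b *m eta b) 0 0 = 0 ->
  \forall t \near almost a b, (L (t : R))^T *m eta t = 0 /\ (B t)^T *m eta t = 0.
Proof.
move=> ab c0 Sa ceta deta Hb.
pose H t := ((eta t)^T *m S c t *m eta t) 0 0.
have cH : {within `[a, b], continuous H}.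
  have cS : {within `[a, b], continuous (S c)} by apply: continuous_subspaceT; exact: continuousS.
  have := within_continuous_mulmx (within_continuous_mulmx (within_continuous_trmx ceta) cS) ceta.
  by move=> cHm t; move: (cHm t) => /cvg_mxP; exact.
have QE t (v : 'cV_n) : (v^T *m Q c t *m v) 0 0 = (alpha t)^-1 *
    ((((G t)^T *m v)^T *m ((G t)^T *m v)) 0 0 +
     c * (((BL t)^T *m v)^T *m ((BL t)^T *m v)) 0 0).
  rewrite /Q -scalemxAr -scalemxAl mulmxDr mulmxDl -scalemxAr -scalemxAl.
  by rewrite !trmx_mul !trmxK !mulmxA mxE mxE [in X in _ + X]mxE.
(* The terms in [F] cancel against the adjoint equation. *)
have dH : \forall t \near almost a b, is_derive (t : R) 1 H (((eta t)^T *m Q c t *m eta t) 0 0).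
  apply: filterS2 deta (almost_derive_S c a b) => t det dSt.
  have := is_derive_mulmx (is_derive_mulmx (is_derive_trmx det) dSt) det.
  rewrite (_ : _ + _ = (eta t)^T *m Q c t *m eta t) => [/is_derive_mxP|]; first exact.
  move: (F t) (S c t) (Q c t) => Ft St Qt.
  rewrite trmx_mul raddfN/= trmxK !(mulmxDl, mulmxDr, mulmxN, mulNmx) !mulmxA.
  by rewrite !addrA addNr add0r addrAC subrr add0r.
have Q0 t (v : 'cV_n) : 0 <= (v^T *m Q c t *m v) 0 0.
  rewrite QE mulr_ge0 ?invr_ge0 ?(ltW (alpha0 t))// addr_ge0 ?mulr_ge0 ?(ltW c0)//;
  exact: mulmx_trl_ge0.
have H0 t : t \in `[a, b] -> H t = 0.
  rewrite in_itv/= => /andP[at_ tb].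
  have mono x y : a <= x -> x <= y -> y <= b -> H x <= H y.
    move=> ax xy yb; apply: (almost_ger0_derive_le xy).
      by apply: continuous_subspaceW cH; apply: subset_itvScc; rewrite bnd_simp.
    by apply: filterS (almost_itvW ax yb dH) => s ds; split; [exact: ds|exact: Q0].
  apply/eqP; rewrite eq_le; apply/andP; split.
    by rewrite -[leRHS]Hb; exact: mono.
  by rewrite (le_trans (Sa (eta a)))// -/(H a) mono.
have inner := almost_inner a b.
near=> t.
have tab : t \in `]a, b[ by near: t.
have dHt : is_derive (t : R) 1 H (((eta t)^T *m Q c t *m eta t) 0 0) by near: t.
have /eqP := is_derive_vanishing H0 tab dHt.
rewrite QE mulf_eq0 invr_eq0 gt_eqF//= paddr_eq0 ?mulr_ge0 ?(ltW c0) ?mulmx_trl_ge0//.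
move=> /andP[_]; rewrite mulf_eq0 gt_eqF//= => /eqP/mulmx_trl_eq0 BLeta.
(* Multiplication by [D] kills [B^T] and turns [D^T L^T] into [L^T]. *)
have Leta : (L t)^T *m eta t = 0.
  have := congr1 (mulmx (D t)) BLeta.
  by rewrite /BL raddfD/= trmx_mul mulmxDl mulmxDr !mulmxA DB mul0mx add0r DD mul1mx mulmx0.
split => //; move: BLeta.
by rewrite /BL raddfD/= trmx_mul mulmxDl -mulmxA Leta mulmx0 addr0.
Unshelve. all: by end_near. Qed.

Lemma periodic_gap_ge0 : controllable A B ->
  forall t (v : 'cV[R]_n), 0 <= (v^T *m (PL t - P t) *m v) 0 0.
Proof.
move=> ctrl a v; rewrite leNgt; apply/negP => vlt0.
have [perP Ppos _] := Psol; have [perPL PLpos _] := PLsol.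
have [c c0 [w [w0 Sw Sge0]]] := pencil_min (PLpos a) vlt0.
(* Steering the [i]-th basis vector to 0 will isolate the [i]-th coordinate of [eta a]; each basis
   vector has its own steering time. *)
have /choice[tau tauP] : forall i : 'I_n, exists tau, a < tau /\
    exists (u : R -> 'cV[R]_m) (x : R -> 'cV[R]_n),
      [/\ piecewise_continuous u, ode_sol x (fun t => A t *m x t + B t *m u t),
          x a = delta_mx i 0 & x tau = 0].
  by move=> i; exact: ctrl.
have [k kP] : exists k : nat, forall i, tau i <= a + T *+ k.+1.
  (* The sum dominates every delay counted in periods; the successor makes up for truncation and
     also ensures [a < b]. *)
  exists (Num.truncn (\sum_i `|(tau i - a) / T|)) => i.
  rewrite -lerBlDl -mulr_natr -ler_pdivrMl// mulrC.
  apply/ltW/(le_lt_trans _ (truncnS_gt _)); rewrite (le_trans (ler_norm _))//.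
  by rewrite (bigD1 i)//= lerDl sumr_ge0.
set b := a + T *+ k.+1 in kP.
have ab : a < b by rewrite ltrDl pmulrn_lgt0.
have Sb : S c b = S c a by rewrite /S /b !Tperiodic_mulrn.
have pcN : piecewise_continuous (fun t => - (F t)^T).
  by apply: piecewise_continuousN; exact: piecewise_continuous_trmx.
have [eta [ceta etab deta]] := linear_ode_backward w ab pcN.
have etaLB := adjoint_kernel ab c0 Sge0 ceta deta.
rewrite etab Sb in etaLB; have {}etaLB := etaLB Sw.
suff etaa : eta a = 0.
  by move: w0; rewrite -etab (linear_ode_eq0 (ltW ab) pcN ceta deta etaa) eqxx.
apply/matrixP => i j; rewrite ord1 mxE {j}.
have [atau [u [x [pcu [cx dx] xa xtau]]]] := tauP i.
have taub := kP i.
pose th t := ((eta t)^T *m x t) 0 0.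
have [K K0 alphaK] := piecewise_continuous_bounded a b pcalpha.
have sub : `[a, tau i] `<=` `[a, b] by apply: subset_itvl; rewrite bnd_simp.
have cth : {within `[a, tau i], continuous th}.
  have ceta' : {within `[a, tau i], continuous eta} by exact: continuous_subspaceW ceta.
  have cx' : {within `[a, tau i], continuous x} by exact: continuous_subspaceT.
  have := within_continuous_mulmx (within_continuous_trmx ceta') cx'.
  by move=> cm t; move: (cm t) => /cvg_mxP; exact.
(* The [A] terms cancel by duality, while the terms in [L] and the control vanish on [eta]; only the
   shift in [F] survives. *)
have dth : \forall t \near almost a (tau i), is_derive (t : R) 1 th (- (alpha t / 2) * th t).
  have cu := piecewise_continuous_almost a (tau i) pcu.
  have cdata := almost_continuous_data a (tau i).
  have {}deta := almost_itvW (lexx a) taub deta.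
  have {}etaLB := almost_itvW (lexx a) taub etaLB.
  near=> t.
  have [cA cB _ _ _] : [/\ {for (t : R), continuous A}, {for (t : R), continuous B},
      {for (t : R), continuous C}, {for (t : R), continuous D} &
      {for (t : R), continuous L} /\ {for (t : R), continuous (alpha : R -> R^o)}] by near: t.
  have cut : {for t, continuous u} by near: t.
  have det : is_derive (t : R) 1 eta (- (F t)^T *m eta t) by near: t.
  have [Leta Beta] : (L t)^T *m eta t = 0 /\ (B t)^T *m eta t = 0 by near: t.
  have dxt : is_derive t 1 x (A t *m x t + B t *m u t).
    apply: dx; apply: cvgD; apply: (@cvg_mulmx _ _ (nbhs t)); [exact: cA|exact: cx|exact: cB|exact: cut].
  have etaL : (eta t)^T *m L t = 0 by rewrite -(trmxK (L t)) -trmx_mul Leta trmx0.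
  have etaB : (eta t)^T *m B t = 0 by rewrite -(trmxK (B t)) -trmx_mul Beta trmx0.
  have := is_derive_mulmx (is_derive_trmx det) dxt.
  rewrite (_ : _ + _ = - (alpha t / 2) *: ((eta t)^T *m x t)).
    by move=> /is_derive_mxP/(_ 0 0); rewrite mxE.
  rewrite trmx_mul raddfN/= trmxK /F mulmxDr !mulmxA etaB mul0mx addr0.
  rewrite mulmxN !mulmxDr mulmxA etaL mul0mx addr0 -scalemxAr mul_mx_scalar.
  by rewrite scalerA mulNmx mulmxDl -scalemxAl opprD addrAC addNr add0r scaleNr.
(* Squaring removes the question of the sign of [th]; since [alpha] is at most [K], the square
   decays at rate at most [K] and cannot reach 0 from a nonzero value. *)
have : th a ^+ 2 * expR (K * a) <= th (tau i) ^+ 2 * expR (K * tau i).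
  apply: (@exp_growth_le _ a (tau i) K (fun t => th t ^+ 2) (fun t => - alpha t * th t ^+ 2)).
  - exact: ltW.
  - by move=> t; apply: cvgM; exact: cth.
  - apply: filterS2 (almost_inner a (tau i)) dth => t tab dt; split.
      rewrite (_ : - alpha t * th t ^+ 2 = th t *: (- (alpha t / 2) * th t)
        + th t *: (- (alpha t / 2) * th t)); last by rewrite /GRing.scale/=; field.
      by under eq_fun do rewrite expr2; exact: is_deriveM.
    rewrite !mulNr lerN2 ler_wpM2r ?sqr_ge0//.
    by rewrite (le_trans (ler_norm _))// alphaK// sub//; exact: subset_itv_oo_cc.
have -> : th (tau i) = 0 by rewrite /th xtau mulmx0 mxE.
rewrite expr0n mul0r pmulr_lle0 ?expR_gt0// => tha.
have : th a = 0 by apply/eqP; rewrite -sqrf_eq0 eq_le tha sqr_ge0.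
by rewrite /th xa -colE !mxE.
Unshelve. all: by end_near. Qed.

End PeriodicGap.

(** * Comparison of sizes and optimality of the gain *)

Lemma mxtrace_conj_ge0 {R : realType} {n q : nat} (M : 'M[R]_n) (W : 'M[R]_(q, n)) :
  (forall v : 'cV[R]_n, 0 <= (v^T *m M *m v) 0 0) -> 0 <= \tr (W *m M *m W^T).
Proof.
move=> M0; rewrite sumr_ge0// => i _.
(* Each diagonal entry is the form of [M] at a transposed row of [W]. *)
have := M0 (row i W)^T; rewrite trmxK -row_mul.
have -> : (row i (W *m M) *m (row i W)^T) 0 0 = (W *m M *m W^T) i i => //.
by rewrite !mxE; apply: eq_bigr => k _; rewrite !mxE.
Qed.

Lemma piecewise_continuous_size_integrable {R : realType} {n q : nat} (T : R)
    (W : R -> 'M[R]_(q, n)) (P : R -> 'M[R]_n) :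
  piecewise_continuous W -> continuous P ->
  lebesgue_measure.-integrable `[0, T] (EFin \o (fun t => \tr (W t *m P t *m (W t)^T))).
Proof.
move=> pcW cP.
have pcP := piecewise_continuous_continuous cP.
have pctr := piecewise_continuous_mxtrace (piecewise_continuous_mulmx
  (piecewise_continuous_mulmx pcW pcP) (piecewise_continuous_trmx pcW)).
have [K _ trK] := piecewise_continuous_bounded 0 T pctr.
exact: almost_continuous_integrable trK (piecewise_continuous_almost 0 T pctr).
Qed.

(** The case [PL = P], [c = 0] of [lyapunov_gap]: for this gain both [S] and [G] vanish, so the two
    right-hand sides agree. *)
Lemma lyapunov_riccati {R : realType} {n m p : nat} (A P : 'M[R]_n) (B : 'M[R]_(n, m))
    (C : 'M[R]_(p, n)) (D : 'M[R]_(p, m)) (al : R) :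
  al != 0 -> P^T = P -> D *m B^T = 0 -> D *m D^T = 1%:M ->
  let L := - (al *: (P *m C^T)) in
  (A + L *m C) *m P + P *m (A + L *m C)^T + al *: P
    + al^-1 *: ((B + L *m D) *m (B + L *m D)^T) =
  A *m P + P *m A^T + al *: P + al^-1 *: (B *m B^T) - al *: (P *m C^T *m C *m P).
Proof.
move=> al0 PT DB DD L.
have := @lyapunov_gap _ _ _ _ A P P B C D L al 0 al0 PT DB DD; cbv zeta.
rewrite subrr !scale0r !addr0 mulmx0 mul0mx add0r /L addNr mul0mx scaler0.
by rewrite addr0; exact: subr0_eq.
Qed.

(** The minimum is expressed by attainment, [P] itself being the ellipsoid matrix of the candidate
    gain, together with a bound against every admissible gain and every periodic solution for it. *)
Theorem theorem5 (R : realType) (n m p q : nat) (T : R)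
    (A : R -> 'M[R]_n) (B : R -> 'M[R]_(n, m)) (C : R -> 'M[R]_(p, n))
    (D : R -> 'M[R]_(p, m)) (Cw : R -> 'M[R]_(q, n)) (alpha : R -> R)
    (P : R -> 'M[R]_n) :
  0 < T ->
  piecewise_continuous A -> piecewise_continuous B ->
  piecewise_continuous C -> piecewise_continuous D ->
  piecewise_continuous Cw -> piecewise_continuous (alpha : R -> R^o) ->
  Tperiodic T A -> Tperiodic T B -> Tperiodic T C -> Tperiodic T D ->
  Tperiodic T Cw -> Tperiodic T alpha ->
  (forall t, 0 < alpha t) ->
  controllable A B -> detectable C A ->
  (forall t, D t *m row_mx (B t)^T (D t)^T = row_mx 0 1%:M) ->
  riccati_sol T A B C alpha P ->
  let Lstar := fun t => - (alpha t *: (P t *m (C t)^T)) in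
  [/\ piecewise_continuous Lstar, Tperiodic T Lstar,
      error_ellipsoid T A B C D alpha Lstar P &
      forall (L : R -> 'M[R]_(n, p)) (PL : R -> 'M[R]_n),
        piecewise_continuous L -> Tperiodic T L ->
        error_ellipsoid T A B C D alpha L PL ->
        ellipsoid_size T Cw P <= ellipsoid_size T Cw PL].
Proof.
move=> T0 pcA pcB pcC pcD pcCw pcalpha _ _ TC _ _ Talpha alpha0 ctrl _ DBD Psol Lstar.
have [TP Ppos [cP dP]] := Psol.
have DB t : D t *m (B t)^T = 0.
  by have := DBD t; rewrite mul_mx_row => /eq_row_mx[].
have DD t : D t *m (D t)^T = 1%:M.
  by have := DBD t; rewrite mul_mx_row => /eq_row_mx[].
split.
- apply: piecewise_continuousN; apply: (piecewise_continuousZ pcalpha).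
  apply: piecewise_continuous_mulmx (piecewise_continuous_trmx pcC).
  exact: piecewise_continuous_continuous.
- by move=> t; rewrite /Lstar TP TC Talpha.
(* The right-hand sides must agree as functions of time, because [ode_sol] also refers to their
   continuity. *)
- split => //; have -> : (fun t => (A t + Lstar t *m C t) *m P t
      + P t *m (A t + Lstar t *m C t)^T + alpha t *: P t
      + (alpha t)^-1 *: ((B t + Lstar t *m D t) *m (B t + Lstar t *m D t)^T)) =
    (fun t => A t *m P t + P t *m (A t)^T + alpha t *: P t
      + (alpha t)^-1 *: (B t *m (B t)^T) - alpha t *: (P t *m (C t)^T *m C t *m P t)).
    apply/funext => t; apply: lyapunov_riccati => //; first by rewrite gt_eqF.
    by have [] := Ppos t.
  by split.
- move=> L PL pcL _ PLsol; have [_ _ [cPL _]] := PLsol.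
  rewrite /ellipsoid_size ler_wpM2l ?invr_ge0 ?(ltW T0)//.
  apply: le_Rintegral => //; [exact: piecewise_continuous_size_integrable..|].
  move=> t _; rewrite -subr_ge0 -raddfB/= -mulmxBl -mulmxBr.
  apply: mxtrace_conj_ge0 => v.
  exact: (periodic_gap_ge0 T0 pcA pcB pcC pcD pcL pcalpha alpha0 DB DD Psol PLsol ctrl).
Qed.
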